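(* Let $m\ge 1$, let $x_1,\ldots,x_m$ be distinct points in the open left half plane $\{s\in\mathbb{C}:\operatorname{Re}(s)<0\}$, and let $y_1,\ldots,y_m\in\mathbb{C}$ be arbitrary (not necessarily distinct), such that the data set $\{(x_j,y_j)\}_{j=1}^m$ is closed under complex conjugation. Then there exists a positive real rational function $f$ of degree at most $m$ such that $f(x_j)=y_j$ for $j=1,\ldots,m$.
   Context: The data set is closed under complex conjugation if, whenever $(x,y)$ is one of the pairs $(x_j,y_j)$, so is $(\overline{x},\overline{y})$ (in particular $y_j\in\mathbb{R}$ if $x_j\in\mathbb{R}$). A rational function $f(s)$ with real coefficients is called positive real if $\operatorname{Re}(f(s))\ge 0$ for all $s$ with $\operatorname{Re}(s)>0$ (so $f$ is analytic there). The degree of a rational function is the maximum of the degrees of its numerator and denominator polynomials (in lowest terms). *)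

(* Defs.v *)
From HB Require Import structures.
From mathcomp Require Import all_boot all_order all_algebra.
From mathcomp Require Import complex.
From mathcomp Require Import reals.

Set Implicit Arguments.
Unset Strict Implicit.
Unset Printing Implicit Defensive.

Import Order.TTheory GRing.Theory Num.Theory.
Local Open Scope ring_scope.
Local Open Scope quotient_scope.
Local Open Scope complex_scope.

Section RationalFunctions.
Variable F : fieldType.
Implicit Type f : {fraction {poly F}}.

(* [repr f] is an arbitrary fraction representing f; dividing out the gcd
   yields numerator and denominator in lowest terms (unique up to a common
   nonzero constant factor). *)
Definition ratnum f : {poly F} :=
  \n_(repr f) %/ gcdp \n_(repr f) \d_(repr f).

Definition ratden f : {poly F} :=
  \d_(repr f) %/ gcdp \n_(repr f) \d_(repr f).

Definition ratdeg f : nat := maxn (size (ratnum f)).-1 (size (ratden f)).-1.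

Lemma ratden_neq0 f : ratden f != 0.
Proof.
by rewrite /ratden dvdp_div_eq0 ?dvdp_gcdr // denom_ratioP.
Qed.

Lemma coprimep_ratnum_ratden f : coprimep (ratnum f) (ratden f).
Proof. by apply: coprimep_div_gcd; rewrite denom_ratioP orbT. Qed.

Lemma ratnum_ratden f :
  f = FracField.tofrac (ratnum f) / FracField.tofrac (ratden f).
Proof.
set r := repr f; set g := gcdp \n_r \d_r.
have d0 : \d_r != 0 by exact: denom_ratioP.
have g0 : g != 0 by rewrite gcdp_eq0 negb_and d0 orbT.
have fE : f = FracField.tofrac \n_r / FracField.tofrac \d_r.
  rewrite -[LHS]reprK -/r.
  apply: (mulIf (x := FracField.tofrac \d_r)); first by rewrite tofrac_eq0.
  rewrite divfK ?tofrac_eq0 // !piE; apply/eqmodP => /=.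
  by rewrite FracField.equivfE /FracField.mulf !numden_Ratio
     ?mulf_neq0 ?oner_neq0 // !mulr1 mulrC.
rewrite {1}fE -[X in FracField.tofrac X / _](divpK (dvdp_gcdl \n_r \d_r)).
rewrite -[X in _ / FracField.tofrac X](divpK (dvdp_gcdr \n_r \d_r)).
by rewrite !tofracM -mulf_div divff ?mulr1 // tofrac_eq0.
Qed.

End RationalFunctions.

Section RealRationalFunctions.
Variable R : realType.
Implicit Types (f : {fraction {poly R}}) (s : R[i]).

(* Since numerator and denominator are coprime, f is analytic at s exactly
   when its denominator does not vanish there. *)
Definition ratdef f s : bool :=
  (map_poly (real_complex R) (ratden f)).[s] != 0.

(* Only meaningful when [ratdef f s]: division by 0 returns 0. *)
Definition rateval f s : R[i] :=
  (map_poly (real_complex R) (ratnum f)).[s] /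
  (map_poly (real_complex R) (ratden f)).[s].

Definition positive_real f : Prop :=
  forall s, 0 < complex.Re s ->
    ratdef f s /\ 0 <= complex.Re (rateval f s).

Definition conj_closed (m : nat) (x y : 'I_m -> R[i]) : Prop :=
  forall j, exists k, x k = (x j)^* /\ y k = (y j)^*.

End RealRationalFunctions.

(* Main.v *)
Require Import Defs.
From mathcomp Require Import all_boot all_order all_algebra.
From mathcomp Require Import complex.
From mathcomp Require Import reals.
Import Order.TTheory GRing.Theory Num.Theory.
Local Open Scope ring_scope.

(** Let b = prod_j (s - x_j) and let U be the Lagrange interpolant, of degree
    less than m, of the values y_j - 1.  Both are real since the data set is
    closed under conjugation.  On Re s > 0 the quantities 1/b and U/b are
    bounded, because |s - x_j| >= - Re x_j > 0.  Hence for K large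
    |U| < |K b + 1| there, so that f = 1 + U / (K b + 1) takes its values in
    the disc |z - 1| < 1, and f(x_j) = 1 + U(x_j) = y_j because b(x_j) = 0. *)

(** * Fractions compared with their reduced form *)

Section Fractions.
Variable F : fieldType.
Implicit Types p q : {poly F}.

(** Lowest terms are fixed only up to a common constant factor, so the reduced pair is compared with
    [p], [q] by cross-multiplication; with coprimality this gives the divisibilities below by
    Gauss's lemma. *)
Lemma ratnum_ratden_cross p q : q != 0 ->
  let f := FracField.tofrac p / FracField.tofrac q in
  ratnum f * q = p * ratden f.
Proof.
move=> q0 f; have := ratnum_ratden f.
rewrite {1}/f => /eqP; rewrite eqr_div ?tofrac_eq0 ?ratden_neq0 //.
by rewrite -!tofracM tofrac_eq => /eqP ->.
Qed.

Lemma ratnum_dvdp p q : q != 0 ->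
  ratnum (FracField.tofrac p / FracField.tofrac q) %| p.
Proof.
move=> q0; rewrite -(Gauss_dvdpl _ (coprimep_ratnum_ratden _)).
by rewrite -ratnum_ratden_cross // dvdp_mulIl.
Qed.

Lemma ratden_dvdp p q : q != 0 ->
  ratden (FracField.tofrac p / FracField.tofrac q) %| q.
Proof.
move=> q0; set f := _ / _.
rewrite -(@Gauss_dvdpr _ _ (ratnum f)); last first.
  by rewrite coprimep_sym coprimep_ratnum_ratden.
by rewrite ratnum_ratden_cross // dvdp_mulIr.
Qed.

Lemma ratdeg_frac_le n p q : q != 0 ->
  (size p <= n.+1)%N -> (size q <= n.+1)%N ->
  (ratdeg (FracField.tofrac p / FracField.tofrac q) <= n)%N.
Proof.
move=> q0 sp sq; rewrite /ratdeg geq_max -!subn1 !leq_subLR !add1n.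
have sd : (size (ratden (FracField.tofrac p / FracField.tofrac q)) <= n.+1)%N.
  by apply: leq_trans sq; apply: dvdp_leq => //; exact: ratden_dvdp.
(* Dividing [p] bounds the size of [ratnum] only when [p] is nonzero; if [p] is zero, the cross
   relation forces [ratnum] to be zero. *)
rewrite sd andbT; have [p0|p0] := eqVneq p 0; last first.
  by apply: leq_trans sp; apply: dvdp_leq => //; exact: ratnum_dvdp.
have /eqP := ratnum_ratden_cross p q q0.
by rewrite {2}p0 mul0r mulf_eq0 (negPf q0) orbF => /eqP ->; rewrite size_poly0.
Qed.

End Fractions.

(** * Real polynomials evaluated at complex points *)

Section RealPolynomials.
Variable R : realType.
Implicit Types (p q : {poly R}) (s : R[i]).
Local Notation toC := (map_poly (real_complex R)).

Lemma rateval_frac p q s : (toC q).[s] != 0 ->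
  let f := FracField.tofrac p / FracField.tofrac q in
  ratdef f s /\ rateval f s = (toC p).[s] / (toC q).[s].
Proof.
move=> qs f.
have q0 : q != 0 by apply: contraNneq qs => ->; rewrite rmorph0 horner0.
have ds : (toC (ratden f)).[s] != 0.
  apply: contraNneq qs => ds; have /dvdpP[r ->] := ratden_dvdp _ p q q0.
  by rewrite rmorphM hornerM ds mulr0.
split=> //; apply/eqP; rewrite /rateval eqr_div // -!hornerM -!rmorphM.
by rewrite ratnum_ratden_cross.
Qed.

Lemma conjc_fixed_poly (P : {poly R[i]}) :
  map_poly conjc P = P -> exists p : {poly R}, toC p = P.
Proof.
move=> PJ; exists (map_poly (@complex.Re R) P); apply/polyP=> i.
rewrite coef_map coef_map_id0 //=.
have := congr1 (fun Q : {poly R[i]} => Q`_i) PJ; rewrite coef_map /=.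
(* A coefficient fixed by conjugation has imaginary part [b] with [- b = b], so [2 b = 0]. *)
case: (P`_i) => a b [] /eqP; rewrite -subr_eq0 -opprD oppr_eq0.
by rewrite -mulr2n mulrn_eq0 /= => /eqP ->.
Qed.

Lemma Re_ge0_disc1 (z : R[i]) : `|z - 1| <= 1 -> 0 <= complex.Re z.
Proof.
move=> z1; have := le_trans (normc_ge_Re (z - 1)) z1.
rewrite lecE /= => /andP[_]; rewrite ler_norml => /andP[+ _].
by case: z {z1} => a b /=; rewrite lerBrDr addNr.
Qed.

(** The strict inequality serves twice: it keeps [q] from vanishing, and after division by [q] it
    puts [p / q] in the unit disc around 1. *)
Lemma positive_real_frac p q :
  (forall s, 0 < complex.Re s -> `|(toC (p - q)).[s]| < `|(toC q).[s]|) ->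
  positive_real (FracField.tofrac p / FracField.tofrac q).
Proof.
move=> pq s /pq lt_pq.
have qs0 : 0 < `|(toC q).[s]| by apply: le_lt_trans lt_pq.
have qs : (toC q).[s] != 0 by rewrite -normr_gt0.
have [? ->] := rateval_frac p q s qs; split=> //; apply: Re_ge0_disc1.
rewrite -[X in `|_ - X|](divff qs) -mulrBl -hornerN -hornerD -rmorphN -rmorphD.
by rewrite normrM normfV ler_pdivrMr // mul1r ltW.
Qed.

End RealPolynomials.

(** * Lagrange interpolation at the nodes *)

Section Lagrange.
Variables (R : realType) (m : nat) (x : 'I_m -> R[i]).
Implicit Types (y : 'I_m -> R[i]) (s : R[i]).

Definition nodal : {poly R[i]} := \prod_i ('X - (x i)%:P).

Definition nodal_rem j : {poly R[i]} := \prod_(i | i != j) ('X - (x i)%:P).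

Definition lagrange_interp y : {poly R[i]} :=
  \sum_j (y j / (nodal_rem j).[x j]) *: nodal_rem j.

Lemma nodalE j : nodal = ('X - (x j)%:P) * nodal_rem j.
Proof. by rewrite /nodal (bigD1 j). Qed.

Lemma size_nodal : size nodal = m.+1.
Proof. by rewrite size_prod_XsubC /index_enum -enumT size_enum_ord. Qed.

Lemma size_nodal_rem j : size (nodal_rem j) = m.
Proof.
have := size_nodal; rewrite (nodalE j) size_monicM ?monicXsubC //.
  by rewrite size_XsubC => -[].
by rewrite monic_neq0 // monic_prod_XsubC.
Qed.

Lemma nodal_root j : nodal.[x j] = 0.
Proof. by rewrite (nodalE j) hornerM hornerXsubC subrr mul0r. Qed.

Lemma nodal_rem_eq0 i j : i != j -> (nodal_rem j).[x i] = 0.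
Proof.
by move=> ij; rewrite /nodal_rem (bigD1 i) //= hornerM hornerXsubC subrr mul0r.
Qed.

Lemma size_lagrange_interp y : (size (lagrange_interp y) <= m)%N.
Proof.
apply: (leq_trans (size_sum _ _ _)); apply/bigmax_leqP => j _.
by apply: leq_trans (size_scale_leq _ _) _; rewrite size_nodal_rem.
Qed.

Lemma horner_lagrange_interp y j :
  injective x -> (lagrange_interp y).[x j] = y j.
Proof.
move=> x_inj; rewrite /lagrange_interp horner_sum (bigD1 j) //= big1 ?addr0.
  rewrite hornerZ divfK // /nodal_rem horner_prod.
  apply/prodf_neq0 => i ij; rewrite hornerXsubC subr_eq0.
  by apply: contra_neq ij => /x_inj.
by move=> i ij; rewrite hornerZ (@nodal_rem_eq0 j i) ?mulr0 // eq_sym.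
Qed.

Section Conjugation.
Variable sigma : 'I_m -> 'I_m.
Hypotheses (x_inj : injective x) (x_sigma : forall j, x (sigma j) = conjc (x j)).

(** Conjugation is an involution and the nodes are distinct. Hence [sigma] permutes the finite index
    set, and products and sums over it can be reindexed. *)
Lemma conj_perm_inj : injective sigma.
Proof.
move=> i j ij; apply: x_inj; rewrite -[LHS]conjcK -[RHS]conjcK.
by rewrite -!x_sigma ij.
Qed.

Lemma conj_nodal : map_poly conjc nodal = nodal.
Proof.
rewrite rmorph_prod /= [RHS](reindex_inj conj_perm_inj).
by apply: eq_bigr => i _; rewrite map_polyXsubC x_sigma.
Qed.

Lemma conj_nodal_rem j : map_poly conjc (nodal_rem j) = nodal_rem (sigma j).
Proof.
rewrite rmorph_prod /= [RHS](reindex_inj conj_perm_inj).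
apply: eq_big => i; first by rewrite (inj_eq conj_perm_inj).
by rewrite map_polyXsubC x_sigma.
Qed.

(** Conjugation carries the summand of index [j] to that of index [sigma j], so it only permutes the
    sum. *)
Lemma conj_lagrange_interp y : (forall j, y (sigma j) = conjc (y j)) ->
  map_poly conjc (lagrange_interp y) = lagrange_interp y.
Proof.
move=> y_sigma; rewrite rmorph_sum /= [RHS](reindex_inj conj_perm_inj).
apply: eq_bigr => j _; rewrite map_polyZ /= conj_nodal_rem; congr (_ *: _).
by rewrite rmorphM fmorphV /= -horner_map /= conj_nodal_rem -x_sigma y_sigma.
Qed.

End Conjugation.

(** * Bounds on the open right half plane *)

Hypothesis x_lhp : forall j, complex.Re (x j) < 0.
(** The distance from [x j] to the imaginary axis, put in [R[i]] because complex norms take their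
    values there. *)
Let a j : R[i] := real_complex R (- complex.Re (x j)).

Let a_gt0 j : 0 < a j.
Proof. by rewrite ltcE /= eqxx oppr_gt0 x_lhp. Qed.

Lemma dist_node_ge s j : 0 < complex.Re s -> a j <= `|s - x j|.
Proof.
move=> s0; apply: le_trans (normc_ge_Re _); rewrite lecE /= eqxx /=.
apply: le_trans (ler_norm _); case: (s) (x j) s0 => [u v] [u' v'] /= s0.
by rewrite lerDr ltW.
Qed.

Lemma nodal_ge s : 0 < complex.Re s -> \prod_j a j <= `|nodal.[s]|.
Proof.
move=> s0; rewrite /nodal horner_prod normr_prod; apply: ler_prod => j _.
by rewrite ltW //= hornerXsubC dist_node_ge.
Qed.

Lemma nodal_rem_le s j : 0 < complex.Re s ->
  `|(nodal_rem j).[s]| <= (a j)^-1 * `|nodal.[s]|.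
Proof.
move=> s0; rewrite (nodalE j) hornerM normrM hornerXsubC mulrA ler_peMl //.
by rewrite mulrC ler_pdivlMr // mul1r dist_node_ge.
Qed.

(** The summand 1 on the left pays for the constant term of the denominator [K b + 1]. *)
Lemma lagrange_interp_dominated y : exists K : R, 0 < K /\
  forall s, 0 < complex.Re s ->
    `|(lagrange_interp y).[s]| + 1 < real_complex R K * `|nodal.[s]|.
Proof.
pose c j := `|y j / (nodal_rem j).[x j]|.
pose D := \sum_j c j * (a j)^-1.
(* Times the norm of [nodal], the first term bounds the interpolant, the second bounds 1, and the
   third makes the inequality strict. *)
pose K := D + (\prod_j a j)^-1 + 1.
have A0 : 0 < \prod_j a j by apply: prodr_gt0 => j _.
have D0 : 0 <= D.
  by apply: sumr_ge0 => j _; apply: mulr_ge0; rewrite ?normr_ge0 ?invr_ge0 ?ltW.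
have K0 : 0 < K by rewrite ltr_wpDl // addr_ge0 // invr_ge0 ltW.
exists (complex.Re K); split; first by move: K0; rewrite ltcE => /andP[].
move=> s s0; rewrite RRe_real ?gtr0_real // /K.
have B0 : 0 < `|nodal.[s]| by apply: lt_le_trans A0 (nodal_ge s s0).
have leU : `|(lagrange_interp y).[s]| <= D * `|nodal.[s]|.
  rewrite /D mulr_suml horner_sum; apply: le_trans (ler_norm_sum _ _ _) _.
  apply: ler_sum => j _; rewrite hornerZ normrM -mulrA ler_wpM2l //.
  exact: nodal_rem_le.
have le1 : 1 <= (\prod_j a j)^-1 * `|nodal.[s]|.
  by rewrite mulrC ler_pdivlMr // mul1r nodal_ge.
by rewrite mulrDl mul1r ltr_pwDr // mulrDl lerD.
Qed.

End Lagrange.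

Theorem mainTheorem1 (R : realType) (m : nat) (x y : 'I_m -> R[i])
    (m_ge1 : (1 <= m)%N)
    (x_inj : injective x)
    (x_lhp : forall j, complex.Re (x j) < 0)
    (xy_conj : conj_closed x y) :
  exists f : {fraction {poly R}},
    [/\ positive_real f,
        (ratdeg f <= m)%N
      & forall j, ratdef f (x j) /\ rateval f (x j) = y j].
Proof.
have [sigma sigmaP] := fin_all_exists xy_conj.
have x_sigma j : x (sigma j) = conjc (x j) by case: (sigmaP j).
pose y1 j := y j - 1.
have y1_sigma j : y1 (sigma j) = conjc (y1 j).
  by rewrite /y1 rmorphB rmorph1; case: (sigmaP j) => _ ->.
have [b bE] := conjc_fixed_poly _ _ (conj_nodal _ _ _ _ x_inj x_sigma).
have [u uE] := conjc_fixed_poly _ _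
  (conj_lagrange_interp _ _ _ _ x_inj x_sigma _ y1_sigma).
have [K [K0 domK]] := lagrange_interp_dominated _ _ _ x_lhp y1.
(* Thus [p / q] is [1 + u / q], and [q] is 1 at each node, where [b] vanishes. *)
pose q := K *: b + 1; pose p := q + u.
have qE s : (map_poly (real_complex R) q).[s] =
    real_complex R K * (nodal R m x).[s] + 1.
  by rewrite rmorphD rmorph1 /= map_polyZ bE hornerD hornerZ hornerC.
have pE s : (map_poly (real_complex R) p).[s] =
    (map_poly (real_complex R) q).[s] + (lagrange_interp R m x y1).[s].
  by rewrite rmorphD hornerD /= uE.
have qx j : (map_poly (real_complex R) q).[x j] = 1.
  by rewrite qE nodal_root mulr0 add0r.
have q0 : q != 0.
  (* As [m] is positive there is a node, and [q] is nonzero because its value there is 1. *)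
  have := qx (Ordinal m_ge1); apply: contra_eq_neq => ->.
  by rewrite rmorph0 horner0 eq_sym oner_neq0.
have sq : (size q <= m.+1)%N.
  apply: leq_trans (size_polyD _ _) _; rewrite geq_max size_poly1 andbT.
  apply: leq_trans (size_scale_leq _ _) _.
  by rewrite -(size_map_poly (real_complex R)) bE size_nodal.
exists (FracField.tofrac p / FracField.tofrac q); split.
- apply: positive_real_frac => s s0.
  rewrite [p]addrC addrK uE qE.
  (* What remains is the reverse triangle inequality [K |b| - 1 <= |K b + 1|]. *)
  have := domK s s0; rewrite -ltrBrDr => /lt_le_trans; apply.
  have K_gt0 : 0 < real_complex R K by rewrite ltcE /= eqxx.
  rewrite -{1}(gtr0_norm K_gt0) -normrM lerBlDr -[X in _ + X]normrN1.
  by apply: le_trans (ler_normD _ _); rewrite addrK.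
- apply: ratdeg_frac_le => //; apply: leq_trans (size_polyD _ _) _.
  rewrite geq_max sq /= -(size_map_poly (real_complex R)) uE.
  by apply: leq_trans (size_lagrange_interp _ _ _ _) _.
- move=> j; have qxj : (map_poly (real_complex R) q).[x j] != 0.
    by rewrite qx oner_neq0.
  have [? ->] := rateval_frac _ p q (x j) qxj; split=> //.
  by rewrite pE qx horner_lagrange_interp // divr1 addrC subrK.
Qed.
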